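(* Let $R\in\mathbb{N}$ and let $u:B_{5R}\to\mathbb{R}$ be harmonic, where $B_{5R}\subseteq\mathbb{Z}^d$. Let $0<\delta<1/4$. Then $$Q_u(2n)\le\sqrt{Q_u(n)\,Q_u\left(\lceil4(1+\delta)n\rceil\right)}+2^{-2n\delta}\,Q_u\left(\lceil4(1+\delta)n\rceil\right)$$ for all integers $0\le n\le R$.
   Context: $\mathbb{Z}^d$ carries its standard nearest-neighbour graph structure, $|x|_1$ denotes graph distance from $0$, and $B_R=\{x\in\mathbb{Z}^d:|x|_1\le R\}$. The Laplacian is $(\Delta f)(x)=\frac{1}{2d}\sum_{y\sim x}(f(y)-f(x))$. A function $u:B_R\to\mathbb{R}$ is harmonic if $(\Delta u)(x)=0$ at every $x$ all of whose neighbours lie in $B_R$ (i.e. $|x|_1\le R-1$). $(X_n)_{n\ge0}$ is the simple random walk on $\mathbb{Z}^d$ starting at $0$, and for $u:B_R\to\mathbb{R}$ and integers $0\le n\le R$, $Q_u(n):=\mathbb{E}(u(X_n)^2)$. *)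

(* Defs.v *)
From mathcomp Require Import all_boot all_order all_algebra.
From mathcomp Require Import all_classical all_reals all_analysis.
Set Implicit Arguments.
Unset Strict Implicit.
Unset Printing Implicit Defensive.
Import Order.TTheory GRing.Theory Num.Theory.
Local Open Scope classical_set_scope.
Local Open Scope ring_scope.

Definition l1norm (d : nat) (x : 'rV[int]_d) : nat :=
  (\sum_(i < d) `|x 0%R i|)%N.

Definition nbrs (d : nat) (x : 'rV[int]_d) : seq 'rV[int]_d :=
  [seq x + delta_mx 0 i | i <- enum 'I_d] ++
  [seq x - delta_mx 0 i | i <- enum 'I_d].

Lemma l1norm_delta (d : nat) (i : 'I_d) :
  l1norm (delta_mx 0 i : 'rV[int]_d) = 1%N.
Proof.
rewrite /l1norm (bigD1 i) //= mxE !eqxx big1 // => j ji.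
by rewrite mxE (negbTE ji) andbF.
Qed.

Lemma l1normN (d : nat) (x : 'rV[int]_d) : l1norm (- x) = l1norm x.
Proof. by apply: eq_bigr => i _; rewrite mxE abszN. Qed.

Lemma mem_nbrs (d : nat) (x y : 'rV[int]_d) :
  (y \in nbrs x) = (l1norm (y - x) == 1%N).
Proof.
rewrite mem_cat; apply/idP/idP.
  case/orP => /mapP[i _ ->]; rewrite addrAC subrr add0r ?l1normN;
  by rewrite l1norm_delta.
move=> /sum_nat_eq1[i [_ /eqP zi1 zj0]].
have yE : y = x + (y - x) by rewrite addrC subrK.
move: (y - x) zi1 zj0 yE => z zi1 zj0 ->{y}.
have -> : z = z 0 i *: delta_mx 0 i.
  apply/rowP => j; rewrite !mxE eqxx /=.
  case: (eqVneq j i) => [->|ji]; first by rewrite mulr1.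
  by apply/eqP; rewrite mulr0 -absz_eq0; apply/eqP/zj0.
case: (z 0 i) zi1 => [[|[|k]]|[|k]] // _.
- by rewrite scale1r; apply/orP; left; apply/mapP; exists i; rewrite ?mem_enum.
- rewrite (_ : Negz 0 = -1) // scaleN1r; apply/orP; right.
  by apply/mapP; exists i; rewrite ?mem_enum.
Qed.

Lemma uniq_nbrs (d : nat) (x : 'rV[int]_d) : uniq (nbrs x).
Proof.
have dinj : injective (fun i : 'I_d => delta_mx 0 i : 'rV[int]_d).
  move=> i j /rowP/(_ i); rewrite !mxE !eqxx /=.
  by case: eqP.
have addI : injective (fun i : 'I_d => x + delta_mx 0 i).
  by move=> i j /addrI; exact: dinj.
have subI : injective (fun i : 'I_d => x - delta_mx 0 i).
  by move=> i j /addrI/oppr_inj; exact: dinj.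
rewrite cat_uniq (map_inj_uniq addI) (map_inj_uniq subI) enum_uniq andbT /=.
apply/hasPn => _ /mapP[i _ ->]; apply/mapP => -[j _] /addrI/rowP/(_ i).
by rewrite !mxE !eqxx /=; case: eqP.
Qed.

Definition laplacian (R : realType) (d : nat) (f : 'rV[int]_d -> R)
    (x : 'rV[int]_d) : R :=
  (2 * d)%:R^-1 * \sum_(y <- nbrs x) (f y - f x).

(* A function on the ball B_r is represented by a total function; its values
   outside B_r are never used, since x and its neighbours are all in B_r. *)
Definition harmonic_on_ball (R : realType) (d r : nat)
    (u : 'rV[int]_d -> R) : Prop :=
  forall x : 'rV[int]_d, (l1norm x <= r)%N ->
    (forall y, y \in nbrs x -> (l1norm y <= r)%N) -> laplacian u x = 0.

(* Initial law and Markov property, the latter multiplied out so that no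
   conditioning on null events is needed. Measurability of [X n] is with respect
   to the discrete sigma-algebra of the countable set Z^d. *)
Definition simple_random_walk (disp : measure_display)
    (T : measurableType disp) (R : realType) (P : probability T R) (d : nat)
    (X : nat -> T -> 'rV[int]_d) : Prop :=
  [/\ forall n x, measurable [set w | X n w = x],
      P [set w | X 0%N w = 0%R] = 1%E
    & forall (n : nat) (x : nat -> 'rV[int]_d),
        P [set w | forall i, (i <= n.+1)%N -> X i w = x i] =
        (P [set w | forall i, (i <= n)%N -> X i w = x i] *
         (if x n.+1 \in nbrs (x n) then (2 * d)%:R^-1 else 0)%:E)%E].

(* [fine] is harmless: a simple random walk started at 0 almost surely has
   |X_n|_1 <= n, so this expectation is finite and depends only on the values
   of u on B_n. *)
Definition walkQ (disp : measure_display) (T : measurableType disp)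
    (R : realType) (P : probability T R) (d : nat)
    (X : nat -> T -> 'rV[int]_d) (u : 'rV[int]_d -> R) (n : nat) : R :=
  fine ('E_P[(fun w => u (X n w) ^+ 2)%R])%E.

(* The natural number ceil(a), for a >= 0. *)
Definition ceiln (R : realType) (a : R) : nat := `|Num.ceil a|%N.

(* Main.v *)
Require Import Defs.
From mathcomp Require Import all_boot all_order all_algebra.
From mathcomp Require Import all_classical all_reals all_analysis.
From mathcomp Require Import measurable_realfun ring lra zify.
Import Order.TTheory GRing.Theory Num.Theory.
Local Open Scope ring_scope.

(** If [u] is harmonic then [laplacian (u^2)] is the average over the unit
    steps [e] of [(gradient u e)^2], and every [gradient u e] is again harmonic
    on a ball of radius one less. Iterating, [a_k := (laplacian^k u^2)(0)] is
    nonnegative as long as [k] does not exceed the radius. Since the walk moves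
    by [1 + laplacian], the binomial theorem gives
    [Q_u(n) = \sum_k 'C(n, k) a_k].
    With [N := ceil(4 (1 + delta) n) <= 5 n], the estimate is then obtained
    term by term: if [k <= 2 n delta] then
    ['C(2n, k)^2 <= 'C(n, k) 'C(N, k)] and Cauchy-Schwarz applies, while if
    [k > 2 n delta] then [2^k 'C(2n, k) <= 'C(N, k)]. *)

(** * Norm and neighbours on the lattice *)

Lemma l1normD (d : nat) (x y : 'rV[int]_d) :
  (l1norm (x + y)%R <= l1norm x + l1norm y)%N.
Proof.
rewrite /l1norm -big_split /=; apply: leq_sum => i _.
by rewrite mxE -lez_nat PoszD !abszE ler_normD.
Qed.

Lemma nbrs_translate (d : nat) (x : 'rV[int]_d) :
  nbrs x = [seq x + e | e <- nbrs 0].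
Proof.
rewrite /nbrs map_cat -!map_comp; congr (_ ++ _); apply: eq_map => i /=;
  by rewrite add0r.
Qed.

Lemma size_nbrs (d : nat) (x : 'rV[int]_d) : size (nbrs x) = (2 * d)%N.
Proof. by rewrite /nbrs size_cat !size_map -enumT size_enum_ord mul2n addnn. Qed.

Lemma l1norm_nbr (d : nat) (x e : 'rV[int]_d) :
  e \in nbrs 0 -> (l1norm (x + e)%R <= (l1norm x).+1)%N.
Proof.
rewrite mem_nbrs subr0 => /eqP e1.
by have := l1normD _ x e; rewrite e1 addn1.
Qed.

(** * Calculus of the discrete Laplacian *)

Section Laplacian.
Context {R : realType} {d : nat}.
Implicit Types (f g u : 'rV[int]_d -> R) (x e : 'rV[int]_d).

Definition gradient u e x : R := u (x + e) - u x.

Definition walk_average f x : R := (2 * d)%:R^-1 * \sum_(y <- nbrs x) f y.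

Lemma laplacianE f x :
  laplacian f x = (2 * d)%:R^-1 * \sum_(e <- nbrs 0) gradient f e x.
Proof. by rewrite /laplacian nbrs_translate big_map. Qed.

Lemma walk_averageE f x : (0 < d)%N -> walk_average f x = f x + laplacian f x.
Proof.
move=> d_gt0; rewrite /walk_average /laplacian sumrB mulrBr addrC.
rewrite big_const_seq count_predT size_nbrs iter_addr_0 -[f x *+ _]mulr_natl.
by rewrite mulKf ?subrK // pnatr_eq0 -lt0n muln_gt0.
Qed.

(** Each Laplacian looks one step further. This allows an identity valid only near [x] to be used
    under the iterate. *)
Lemma iter_laplacian_local k f g x :
  (forall y, (l1norm y <= l1norm x + k)%N -> f y = g y) ->
  iter k (@laplacian R d) f x = iter k (@laplacian R d) g x.
Proof.
elim: k x => [|k IH] x fg /=; first by apply: fg; rewrite addn0.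
rewrite !laplacianE; congr (_ * _); apply: eq_big_seq => e xe.
rewrite /gradient (IH (x + e)) => [|y yx]; last first.
  by apply: fg; have := l1norm_nbr _ x e xe; lia.
by rewrite (IH x) // => y yx; apply: fg; lia.
Qed.

Lemma laplacian_sum (I : Type) (s : seq I) (c : I -> R)
    (F : I -> 'rV[int]_d -> R) x :
  laplacian (fun y => \sum_(i <- s) c i * F i y) x =
  \sum_(i <- s) c i * laplacian (F i) x.
Proof.
rewrite laplacianE /gradient.
under eq_bigr do rewrite -sumrB.
rewrite exchange_big mulr_sumr; apply: eq_bigr => i _.
rewrite laplacianE mulrCA; congr (_ * _).
by rewrite mulr_sumr; apply: eq_bigr => e _; rewrite -mulrBr.
Qed.

Lemma iter_laplacian_sum k (I : Type) (s : seq I) (c : I -> R)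
    (F : I -> 'rV[int]_d -> R) :
  iter k (@laplacian R d) (fun y => \sum_(i <- s) c i * F i y) =
  fun x => \sum_(i <- s) c i * iter k (@laplacian R d) (F i) x.
Proof.
elim: k => //= k ->; apply/funext => x; exact: laplacian_sum.
Qed.

Lemma laplacian_gradient u e x :
  laplacian (gradient u e) x = laplacian u (x + e) - laplacian u x.
Proof.
rewrite !laplacianE -mulrBr -sumrB; congr (_ * _); apply: eq_bigr => a _.
by rewrite /gradient (addrAC x a e); ring.
Qed.

(** Since [b^2 - a^2 = (b - a)^2 + 2 a (b - a)], the cross terms add up to a multiple of
    [laplacian u x]. *)
Lemma laplacian_sqr u x : laplacian u x = 0 ->
  laplacian (fun y => u y ^+ 2) x =
  \sum_(e <- nbrs 0) (2 * d)%:R^-1 * gradient u e x ^+ 2.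
Proof.
move=> ux0; rewrite -mulr_sumr.
have -> : \sum_(e <- nbrs 0) gradient u e x ^+ 2 =
    \sum_(e <- nbrs 0) gradient (fun y => u y ^+ 2) e x -
    2 * u x * \sum_(e <- nbrs 0) gradient u e x.
  rewrite mulr_sumr -sumrB; apply: eq_bigr => e _.
  by rewrite /gradient; ring.
by rewrite mulrBr -laplacianE mulrCA -laplacianE ux0 mulr0 subr0.
Qed.

Lemma iter_laplacian_sqr_ge0 k m u x :
  (forall y, (l1norm y < m)%N -> laplacian u y = 0) ->
  (l1norm x + k <= m)%N -> 0 <= iter k (@laplacian R d) (fun y => u y ^+ 2) x.
Proof.
elim: k m u => [|k IH] m u hu xm /=; first exact: sqr_ge0.
(* The innermost Laplacian becomes a sum of squared gradients. Locality asks for this only up to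
   norm [l1norm x + k], which is below [m]. *)
rewrite -iterS iterSr (iter_laplacian_local _ _ (fun y =>
  \sum_(e <- nbrs 0) (2 * d)%:R^-1 * gradient u e y ^+ 2)); last first.
  by move=> y yx; apply/laplacian_sqr/hu; lia.
rewrite iter_laplacian_sum big_seq; apply: sumr_ge0 => e e0.
(* A gradient involves both [y] and [y + e], hence the radius [m.-1]; the unit lost pays for the
   iteration spent. *)
rewrite mulr_ge0 ?invr_ge0 ?ler0n //; apply: (IH m.-1); last by lia.
move=> y ym; rewrite laplacian_gradient !hu ?subrr //; first by lia.
by have := l1norm_nbr _ y e e0; lia.
Qed.

(** Any range beyond [n] will do, as the extra binomials vanish; all times can thus share one
    range. *)
Lemma iter_walk_averageE f x (n m : nat) : (0 < d)%N -> (n < m)%N ->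
  iter n walk_average f x =
  \sum_(k < m) 'C(n, k)%:R * iter k (@laplacian R d) f x.
Proof.
move=> d_gt0; elim: n x m => [|n IH] x [|m] // nm.
  rewrite big_ord_recl /= bin0 mul1r big1 ?addr0 // => i _.
  by rewrite bin0n mul0r.
have Sn : iter n.+1 walk_average f x =
    iter n walk_average f x + laplacian (iter n walk_average f) x.
  exact: walk_averageE.
(* The two expansions use ranges [m.+1] and [m]: the extra Laplacian shifts the second by one, and
   Pascal's rule merges them. *)
rewrite Sn {1}(IH x m.+1 (ltnW nm)).
have -> : iter n walk_average f =
    fun y => \sum_(k < m) 'C(n, k)%:R * iter k (@laplacian R d) f y.
  by apply/funext => y; exact: IH.
rewrite laplacian_sum [in LHS]big_ord_recl [RHS]big_ord_recl /= !bin0 -addrA.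
congr (_ + _); rewrite -big_split /=; apply: eq_bigr => i _.
by rewrite /bump /= add1n binS natrD mulrDl.
Qed.

End Laplacian.

(** * Comparison of binomial coefficients *)

Lemma ffact_prodE (n k : nat) : (n ^_ k = \prod_(i < k) (n - i))%N.
Proof.
elim: k => [|k IH]; first by rewrite big_ord0 ffactn0.
by rewrite big_ord_recr -IH ffactnSr.
Qed.

(** Multiplied by [k!], both sides are products, and [2 * (n - i) <= m - i] for each factor, even
    when subtraction truncates. *)
Lemma leq_exp2_bin (n m k : nat) : (2 * n <= m)%N ->
  (2 ^ k * 'C(n, k) <= 'C(m, k))%N.
Proof.
move=> nm; rewrite -(leq_pmul2r (fact_gt0 k)) -mulnA !bin_ffact !ffact_prodE.
rewrite -{1}[k]card_ord -prod_nat_const -big_split /=.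
by apply: leq_prod => i _; lia.
Qed.

Lemma leq_bin_sqr (n m p k : nat) :
  (forall i, (i < k)%N -> ((n - i) ^ 2 <= (m - i) * (p - i))%N) ->
  ('C(n, k) ^ 2 <= 'C(m, k) * 'C(p, k))%N.
Proof.
move=> le_nmp.
have k2 : (0 < k`! ^ 2)%N by rewrite expn_gt0 fact_gt0.
rewrite -(leq_pmul2r k2) -!mulnn [leqLHS]mulnACA [leqRHS]mulnACA !bin_ffact.
rewrite !ffact_prodE -!big_split /=; apply: leq_prod => i _.
by have := le_nmp i (ltn_ord i); rewrite mulnn.
Qed.

(** * Cauchy-Schwarz without square roots *)

Section CauchySchwarz.
Context {R : realFieldType}.

Lemma sqrD_le_mulDD (x y z x' y' z' : R) :
  0 <= x -> 0 <= y -> 0 <= z -> 0 <= x' -> 0 <= y' -> 0 <= z' ->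
  z ^+ 2 <= x * y -> z' ^+ 2 <= x' * y' ->
  (z + z') ^+ 2 <= (x + x') * (y + y').
Proof.
move=> x0 y0 z0 x'0 y'0 z'0 zxy zxy'.
(* AM-GM for [x * y'] and [x' * y], whose product bounds [(z * z')^2]. *)
have cross : 2 * (z * z') <= x * y' + x' * y.
  rewrite -(@ler_pXn2r _ 2) ?nnegrE ?addr_ge0 ?mulr_ge0 //.
  apply: (@le_trans _ _ (4 * ((x * y) * (x' * y')))).
    have -> : (2 * (z * z')) ^+ 2 = 4 * (z ^+ 2 * z' ^+ 2) by ring.
    by rewrite ler_pM2l // ler_pM ?sqr_ge0.
  rewrite -subr_ge0.
  have -> : (x * y' + x' * y) ^+ 2 - 4 * (x * y * (x' * y')) =
    (x * y' - x' * y) ^+ 2 by ring.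
  exact: sqr_ge0.
have -> : (z + z') ^+ 2 = z ^+ 2 + z' ^+ 2 + 2 * (z * z') by ring.
have -> : (x + x') * (y + y') = x * y + x' * y' + (x * y' + x' * y) by ring.
by rewrite !lerD.
Qed.

Lemma sqr_sum_le_mul_sum (I : Type) (s : seq I) (P : pred I) (x y z : I -> R) :
  (forall i, P i -> [/\ 0 <= x i, 0 <= y i & 0 <= z i]) ->
  (forall i, P i -> z i ^+ 2 <= x i * y i) ->
  (\sum_(i <- s | P i) z i) ^+ 2 <=
  (\sum_(i <- s | P i) x i) * (\sum_(i <- s | P i) y i).
Proof.
move=> ge0 zxy.
suff [_ _ _] : [/\ 0 <= \sum_(i <- s | P i) x i, 0 <= \sum_(i <- s | P i) y i,
    0 <= \sum_(i <- s | P i) z i &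
    (\sum_(i <- s | P i) z i) ^+ 2 <=
    (\sum_(i <- s | P i) x i) * (\sum_(i <- s | P i) y i)] by [].
apply: (big_rec3 (fun a b c : R => [/\ 0 <= a, 0 <= b, 0 <= c & c ^+ 2 <= a * b])).
  by rewrite expr0n mulr0.
move=> i a b c Pi [a0 b0 c0 cab]; have [x0 y0 z0] := ge0 i Pi.
by split; rewrite ?addr_ge0 // sqrD_le_mulDD // zxy.
Qed.

End CauchySchwarz.

(** * The inequality for binomial sums with nonnegative coefficients *)

Section AbsolutelyMonotone.
Context {R : realType} (a : nat -> R).

Lemma abs_monotone_three_spheres (delta : R) (n m : nat) (Q : nat -> R) :
  0 < delta -> delta < 1 / 4 -> 4 * (1 + delta) * n%:R <= m%:R ->
  (forall k, (k <= m)%N -> 0 <= a k) ->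
  (forall j, (j <= m)%N -> Q j = \sum_(k < m.+1) 'C(j, k)%:R * a k) ->
  Q (2 * n)%N <= Num.sqrt (Q n * Q m) + 2 `^ (- (2 * n%:R * delta)) * Q m.
Proof.
move=> delta0 delta4 le_m a_ge0 Q_E.
have n0 : 0 <= n%:R :> R by [].
have nm4 : (4 * n <= m)%N by rewrite -(ler_nat R) natrM; nra.
have b_ge0 j (k : 'I_m.+1) : 0 <= 'C(j, k)%:R * a k.
  by rewrite mulr_ge0 // a_ge0 // -ltnS.
rewrite !Q_E //; [|lia..].
set c := 2 * n%:R * delta.
rewrite (bigID (fun k : 'I_m.+1 => k%:R <= c)) /=; apply: lerD.
  rewrite -[leLHS]ger0_norm ?sumr_ge0 // -sqrtr_sqr; apply: ler_wsqrtr.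
  apply: (@le_trans _ _ ((\sum_(k < m.+1 | k%:R <= c) 'C(n, k)%:R * a k) *
                         (\sum_(k < m.+1 | k%:R <= c) 'C(m, k)%:R * a k))).
    apply: sqr_sum_le_mul_sum => k kc //.
    rewrite exprMn [leRHS]mulrACA -expr2 ler_wpM2r ?sqr_ge0 // -natrX -natrM ler_nat.
    apply: leq_bin_sqr => i ik.
    have ic : i%:R <= c by apply: le_trans kc; rewrite ler_nat ltnW.
    (* From [delta < 1/4] one gets [c <= n/2], so the natural subtractions below do not truncate. *)
    have i_le_n : (i <= n)%N by rewrite -(ler_nat R); rewrite /c in ic; nra.
    rewrite -(ler_nat R) natrX natrM !natrB ?natrM; [|lia..].
    have i0 : 0 <= i%:R :> R by [].
    have i_le_nR : i%:R <= n%:R :> R by rewrite ler_nat.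
    (* This product equals [(n - i) (4 (1 + delta) n - i) - (2 n - i)^2]. It is nonnegative because
       [i <= 2 n delta] and [1 + 4 delta < 2]. *)
    have : 0 <= n%:R * (4 * delta * n%:R - i%:R * (1 + 4 * delta)).
      rewrite mulr_ge0 // subr_ge0; rewrite /c in ic; nra.
    have := ler_wpM2l (_ : 0 <= n%:R - i%:R) le_m.
    rewrite subr_ge0 => /(_ i_le_nR); nra.
  by apply: ler_pM; rewrite ?sumr_ge0 //;
    rewrite [leRHS](bigID (fun k : 'I_m.+1 => k%:R <= c)) /= lerDl sumr_ge0.
rewrite [in leRHS](bigID (fun k : 'I_m.+1 => k%:R <= c)) /= mulrDr.
rewrite ler_wpDl ?mulr_ge0 ?powR_ge0 ?sumr_ge0 // mulr_sumr.
apply: ler_sum => k; rewrite -ltNge => ck.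
rewrite mulrA ler_wpM2r ?a_ge0 -1?ltnS // powRN.
rewrite ler_pdivlMl ?powR_gt0 //.
(* Here [c < k] gives [2^c <= 2^k], and [leq_exp2_bin] applies since [4 n <= m]. *)
apply: (@le_trans _ _ ((2 ^ k * 'C(2 * n, k))%N%:R)).
  rewrite natrM ler_wpM2r // natrX -powR_mulrn // ler_powR ?ltW //; lra.
by rewrite ler_nat leq_exp2_bin // mulnA.
Qed.
End AbsolutelyMonotone.

Local Open Scope classical_set_scope.

(** * Expectations of the walk as iterated averages *)

Section RandomWalk.
Context {disp : measure_display} {T : measurableType disp} {R : realType}.
Context {P : probability T R} {d : nat} {X : nat -> T -> 'rV[int]_d}.
Hypotheses (d_gt0 : (0 < d)%N) (hX : simple_random_walk P X).
Implicit Types (f : 'rV[int]_d -> R) (p : nat -> 'rV[int]_d).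

Definition history n p : set T := [set w | forall i, (i <= n)%N -> X i w = p i].

(** Paths are total functions, as in [simple_random_walk]; values after time [n.+1] do not affect
    [history n.+1]. *)
Definition extend n p (y : 'rV[int]_d) (i : nat) := if i == n.+1 then y else p i.

Lemma measurable_walk_preimage n (B : set 'rV[int]_d) : measurable (X n @^-1` B).
Proof.
have [mX _ _] := hX.
rewrite (_ : _ @^-1` _ = \bigcup_x (if x \in B then [set w | X n w = x] else set0)).
  apply: countable_bigcupT_measurable; first exact: countableP.
  by move=> x; case: ifP.
apply/seteqP; split => w /=.
  by move=> Bw; exists (X n w) => //; rewrite mem_set.
by move=> [x _]; case: ifPn => //; rewrite inE => Bx /= ->.
Qed.

Lemma measurable_fun_walk n f D : measurable D ->
  measurable_fun D (EFin \o (fun w => f (X n w))).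
Proof.
move=> mD; apply/measurable_EFinP => _ B mB; apply: measurableI => //.
exact: (measurable_walk_preimage n (f @^-1` B)).
Qed.

Lemma measurable_history n p : measurable (history n p).
Proof.
rewrite (_ : history n p = \bigcap_(i in [set i | (i <= n)%N]) X i @^-1` [set p i]).
  by apply: bigcap_measurable => [|i _]; [exists 0%N|exact: measurable_walk_preimage].
by apply/seteqP; split => w /= h i /h.
Qed.

Lemma history_extend n p y :
  history n.+1 (extend n p y) = history n p `&` [set w | X n.+1 w = y].
Proof.
apply/seteqP; split => w /=.
  move=> h; split; last by rewrite (h n.+1) // /extend eqxx.
  by move=> i i_le_n; rewrite h ?(leqW i_le_n) // /extend ltn_eqF.
move=> [h Xy] i; rewrite /extend; case: eqP => [-> //|/eqP ni] i_le.
by apply: h; rewrite -ltnS ltn_neqAle ni.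
Qed.

Lemma probability_history_extend n p y : y \in nbrs (p n) ->
  P (history n.+1 (extend n p y)) = (P (history n p) * (2 * d)%:R^-1%:E)%E.
Proof.
move=> yp; have [_ _ /(_ n (extend n p y))] := hX.
rewrite /history {3 4}/extend eqxx ltn_eqF // yp => ->; congr (P _ * _)%E.
apply/seteqP; split => w h i i_le_n; have := h i i_le_n;
  by rewrite /extend ltn_eqF.
Qed.

Lemma trivIset_history_extend n p :
  trivIset setT (fun y => history n.+1 (extend n p y)).
Proof.
move=> x y _ _ [w]; rewrite !history_extend => -[] [_ /= <-] [_ /= <-].
by [].
Qed.

Lemma sum_nbrs_mean (x : 'rV[int]_d) : (2 * d)%:R^-1 *+ size (nbrs x) = 1 :> R.
Proof.
by rewrite size_nbrs -[LHS]mulr_natl divff // pnatr_eq0 -lt0n muln_gt0.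
Qed.

(** The Markov property in integrated form, by induction on [k], splitting on the next step. As [f]
    is nonnegative, integrals can be cut up without integrability checks. *)
Lemma integral_history n k p f : (forall x, 0 <= f x) ->
  (\int[P]_(w in history n p) (f (X (n + k) w))%:E =
   P (history n p) * (iter k walk_average f (p n))%:E)%E.
Proof.
move=> f_ge0; elim: k n p => [|k IH] n p.
  rewrite addn0 (eq_integral (cst (f (p n))%:E)) ?integral_cst 1?muleC //.
    exact: measurable_history.
  by move=> w; rewrite inE => /(_ n (leqnn n)) ->.
pose F y := history n.+1 (extend n p y).
pose D := \big[setU/set0]_(y <- nbrs (p n)) F y.
have mF y : measurable (F y) by exact: measurable_history.
have mD : measurable D by exact: bigsetU_measurable.
have tF : trivIset [set` nbrs (p n)] F.
  by apply: sub_trivIset (trivIset_history_extend n p).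
have mH := measurable_history n p.
have PF y : y \in nbrs (p n) -> P (F y) = (P (history n p) * (2 * d)%:R^-1%:E)%E.
  exact: probability_history_extend.
have DH : D `<=` history n p.
  by rewrite /D -bigcup_seq => w [y _]; rewrite /F history_extend => -[].
have [q PH] : exists q, P (history n p) = q%:E.
  by exists (fine (P (history n p))); rewrite fineK ?fin_num_measure.
have int_D (g : T -> \bar R) : measurable_fun D g -> (forall w, D w -> 0 <= g w)%E ->
    (\int[P]_(w in D) g w = \sum_(y <- nbrs (p n)) \int[P]_(w in F y) g w)%E.
  by apply: ge0_integral_bigsetU => //; exact: uniq_nbrs.
(* Each of the [2 d] disjoint extensions carries a share [1 / (2 d)] of the mass, so together they
   fill the history up to a null set. *)
have PD : P D = P (history n p).
  have := int_D (cst 1%E) (measurable_cst _) (fun _ _ => lee01).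
  rewrite integral_cst // mul1e => ->.
  rewrite (eq_big_seq (fun=> (q * (2 * d)%:R^-1)%:E)) => [|y yp]; last first.
    by rewrite integral_cst // mul1e EFinM -PH; exact: PF.
  rewrite sumEFin -mulr_sumr big_const_seq count_predT iter_addr_0.
  by rewrite sum_nbrs_mean mulr1 PH.
have mN : measurable (history n p `\` D) by exact: measurableD.
rewrite (ge0_negligible_integral mN) //.
- rewrite setDD setIidr // int_D; last 2 first.
  + exact: measurable_fun_walk.
  + by move=> w _; rewrite lee_fin.
  rewrite iterS /walk_average mulr_sumr PH -EFinM mulr_sumr -sumEFin.
  (* Reading [n + k.+1] as [n.+1 + k] makes the induction hypothesis apply to each extension, which
     ends at [y]. *)
  apply: eq_big_seq => y yp; rewrite -addSnnS IH PF // PH /extend eqxx.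
  by rewrite -!EFinM mulrA.
- exact: measurable_fun_walk.
- by move=> w _; rewrite lee_fin.
- have PH_fin : (P (history n p) < +oo)%E by rewrite PH ltry.
  rewrite measureD // setIidr //.
  have : (P (history n p) - P D = 0)%E by rewrite PD PH subee.
  exact.
Qed.

(** The walk starts at 0 almost surely, so restricting to that history of length 0 loses only a null
    set. *)
Lemma walkQE (u : 'rV[int]_d -> R) n :
  walkQ P X u n = iter n walk_average (fun x => u x ^+ 2) 0.
Proof.
rewrite /walkQ unlock.
have [_ P0 _] := hX.
have H0 : history 0 (fun=> 0) = [set w | X 0%N w = 0].
  by apply/seteqP; split => w /= => [h|h [|i]]; [exact: h | |].
have mH := measurable_history 0 (fun=> 0).
have PC : P (~` history 0 (fun=> 0)) = 0%E.
  by rewrite probability_setC // H0 P0 subee.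
rewrite (ge0_negligible_integral (measurableC mH)) //; last 2 first.
- exact: (measurable_fun_walk n (fun x => u x ^+ 2)).
- by move=> w _; rewrite lee_fin sqr_ge0.
rewrite setTD setCK (integral_history 0 n _ (fun x => u x ^+ 2)).
  by rewrite H0 P0 mul1e.
by move=> x; exact: sqr_ge0.
Qed.
End RandomWalk.

Local Close Scope classical_set_scope.

(** * Application to harmonic functions *)

Theorem theorem1p16 (R : realType) (disp : measure_display)
    (T : measurableType disp) (P : probability T R)
    (d : nat) (hd : (0 < d)%N)
    (X : nat -> T -> 'rV[int]_d) (hX : simple_random_walk P X)
    (r : nat) (u : 'rV[int]_d -> R) (hu : harmonic_on_ball (5 * r)%N u)
    (delta : R) (hdelta0 : 0 < delta) (hdelta1 : delta < 1 / 4)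
    (n : nat) (hn : (n <= r)%N) :
  walkQ P X u (2 * n)%N <=
    Num.sqrt (walkQ P X u n *
              walkQ P X u (ceiln (4 * (1 + delta) * n%:R)))
    + 2 `^ (- (2 * n%:R * delta)) *
      walkQ P X u (ceiln (4 * (1 + delta) * n%:R)).

Proof.
set N := ceiln _.
have n_ge0 : 0 <= n%:R :> R by [].
have a_ge0 : 0 <= 4 * (1 + delta) * n%:R.
  by rewrite mulr_ge0 // mulr_ge0 //; lra.
have ceil_ge0 : 0 <= Num.ceil (4 * (1 + delta) * n%:R).
  by rewrite -(ler_int R) (le_trans a_ge0) // ceil_ge.
have a_le_N : 4 * (1 + delta) * n%:R <= N%:R.
  by rewrite /N /ceiln natr_absz ger0_norm // ceil_ge.
have N_le : (N <= 5 * r)%N.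
  (* This is where the radius [5 * r] enters: [4 (1 + delta) < 5], and [5 * n] is an integer, so the
     ceiling does not exceed it. *)
  apply: (@leq_trans (5 * n)%N); last by rewrite leq_mul2l hn.
  rewrite /N /ceiln -lez_nat abszE ger0_norm // ceil_le_int.
  by rewrite -[X in _ <= X]/((5 * n)%:R) natrM; nra.
apply: (@abs_monotone_three_spheres R
  (fun k => iter k (@laplacian R d) (fun x => u x ^+ 2) 0)) => // [k k_le|j j_le].
  apply: (@iter_laplacian_sqr_ge0 R d k (5 * r)%N); last first.
    by rewrite (_ : l1norm 0 = 0%N) ?(leq_trans k_le) //
      /l1norm big1 // => i _; rewrite mxE.
  (* The strict bound on [y] keeps all its neighbours in the ball. *)
  move=> y y_lt; apply: hu => [|z]; first exact: ltnW.
  by rewrite nbrs_translate => /mapP[e e0 ->]; rewrite (leq_trans (l1norm_nbr _ y e e0)).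
by rewrite (walkQE hd hX) (@iter_walk_averageE R d _ _ _ N.+1).
Qed.
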